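(* Let $G$ be a finite simple graph that is $\{K_5-e, K_2\cup 2K_1\}$-free. Then $\chi(G)\le \omega(G)+1$.
   Context: $\chi(G)$ is the chromatic number and $\omega(G)$ the clique number. $K_5-e$ is the complete graph on five vertices with one edge removed. $K_2\cup 2K_1$ is the disjoint union of an edge and two isolated vertices. A graph is $\{H_1,\dots,H_k\}$-free if it has no induced subgraph isomorphic to any $H_i$. *)

(* Defs.v *)
From Stdlib Require List.
From mathcomp Require Import all_boot.

Set Implicit Arguments.
Unset Strict Implicit.
Unset Printing Implicit Defensive.

Record sgraph := SGraph {
  vertex :> finType;
  adj : rel vertex;
  adj_sym : symmetric adj;
  adj_irrefl : irreflexive adj }.

Definition isomorphic (G H : sgraph) : Prop :=
  exists f : G -> H, bijective f /\ {mono f : x y / adj x y}.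

Section InducedSubgraph.
Variables (G : sgraph) (S : {set G}).

Definition induced_adj : rel {x : G | x \in S} :=
  fun x y => adj (val x) (val y).

Lemma induced_adj_sym : symmetric induced_adj.
Proof. by move=> x y; apply: adj_sym. Qed.

Lemma induced_adj_irrefl : irreflexive induced_adj.
Proof. by move=> x; apply: adj_irrefl. Qed.

Definition induced : sgraph := SGraph induced_adj_sym induced_adj_irrefl.
End InducedSubgraph.

Definition free (Hs : seq sgraph) (G : sgraph) : Prop :=
  forall H, List.In H Hs -> ~ exists S : {set G}, isomorphic (induced S) H.

Definition clique (G : sgraph) (A : {set G}) : bool :=
  [forall x in A, forall y in A, (x != y) ==> adj x y].

Definition omega (G : sgraph) : nat := \max_(A : {set G} | clique A) #|A|.

Definition proper_coloring (G : sgraph) (k : nat) (c : {ffun G -> 'I_k}) : bool :=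
  [forall x, forall y, adj x y ==> (c x != c y)].

Definition colorable (G : sgraph) (k : nat) : bool :=
  [exists c : {ffun G -> 'I_k}, proper_coloring c].

Lemma colorable_ex (G : sgraph) : exists k, colorable G k.
Proof.
exists #|G|; apply/existsP; exists [ffun x => enum_rank x].
apply/forallP=> x; apply/forallP=> y; apply/implyP=> xy; rewrite !ffunE.
by apply: contraTneq xy => /enum_rank_inj ->; rewrite adj_irrefl.
Qed.

Definition chi (G : sgraph) : nat := ex_minn (colorable_ex G).

Section Complete.
Variable n : nat.

Definition complete_adj : rel 'I_n := fun x y => x != y.

Lemma complete_adj_sym : symmetric complete_adj.
Proof. by move=> x y; rewrite /complete_adj eq_sym. Qed.

Lemma complete_adj_irrefl : irreflexive complete_adj.
Proof. by move=> x; rewrite /complete_adj eqxx. Qed.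

Definition complete : sgraph := SGraph complete_adj_sym complete_adj_irrefl.
End Complete.

Section DeleteEdge.
Variables (G : sgraph) (u v : G).

Definition delete_edge_adj : rel G :=
  fun x y => adj x y && ([set x; y] != [set u; v]).

Lemma delete_edge_adj_sym : symmetric delete_edge_adj.
Proof. by move=> x y; rewrite /delete_edge_adj adj_sym setUC. Qed.

Lemma delete_edge_adj_irrefl : irreflexive delete_edge_adj.
Proof. by move=> x; rewrite /delete_edge_adj adj_irrefl. Qed.

Definition delete_edge : sgraph :=
  SGraph delete_edge_adj_sym delete_edge_adj_irrefl.
End DeleteEdge.

Section DisjointUnion.
Variables G H : sgraph.

Definition disjoint_union_adj : rel (G + H)%type := fun x y =>
  match x, y with
  | inl a, inl b => adj a b
  | inr a, inr b => adj a b
  | _, _ => false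
  end.

Lemma disjoint_union_adj_sym : symmetric disjoint_union_adj.
Proof. by move=> [x|x] [y|y] //=; apply: adj_sym. Qed.

Lemma disjoint_union_adj_irrefl : irreflexive disjoint_union_adj.
Proof. by move=> [x|x] /=; apply: adj_irrefl. Qed.

Definition disjoint_union : sgraph :=
  SGraph disjoint_union_adj_sym disjoint_union_adj_irrefl.
End DisjointUnion.

(* By the symmetry of K_5 the choice of the deleted edge is immaterial. *)
Definition K5_minus_e : sgraph := @delete_edge (complete 5) ord0 ord_max.

Definition K2_cup_2K1 : sgraph :=
  disjoint_union (complete 2) (disjoint_union (complete 1) (complete 1)).

(* Main.v *)
Require Import Defs.
From mathcomp Require Import all_boot.

(* Induct on w, a bound for the clique number of a vertex set A.  If three
   pairwise nonadjacent vertices extend to a maximal independent set I, every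
   vertex outside I misses at most one element of I.  A w-clique K avoiding I
   then needs w = 3, since a vertex outside K has at most two neighbours in K
   but K has at least 2w adjacencies with three vertices of I; if there is no
   such K, one colour for I and induction suffice.  If A has independence
   number at most 2, fix a w-clique K: either the rest is a clique, and an
   almost perfect matching of non-edges gives the colouring, or w <= 4.
   The cases that remain contain an explicit small induced subgraph: K_1, K_2,
   K_3, K_4 plus two vertices, or the 3-sun.  Other vertices are classified by
   their adjacency to it, and branching on whether a vertex with a given
   adjacency occurs ends after a few steps in a situation where colouring each
   class with a single colour is forced to be proper. *)

Set Implicit Arguments.
Unset Strict Implicit.
Unset Printing Implicit Defensive.

(** * Search trees *)

Section Patterns.
Variables (X : Type) (r : rel X).

Fixpoint has_clique k (s : seq X) :=
  if k is k'.+1 then has (fun a => has_clique k' (filter (r a) s)) s else true.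

(* The vertex [x], added to the vertices of [s], creates a clique of size
   [w.+1], an induced [K_5 - e] with [x] of degree 4 or 3, or an induced
   [K_2 + 2 K_1] with [x] isolated or not.  If [alpha2] is set, an independent
   triple through [x] counts as well. *)
Definition completes_pattern (alpha2 : bool) w (x : X) (s : seq X) :=
  let N := [seq y <- s | r x y] in
  let O := [seq y <- s | ~~ r x y] in
  [|| has_clique w N,
      has (fun a => let Na := filter (r a) N in
           has (fun b => ~~ pairwise r (filter (r b) Na)) Na) N,
      has (fun b => let C := filter (r b) N in
           has (fun a => has (fun c => has (r c) (filter (r a) C)) (filter (r a) C)) C) O,
      has (fun a => has (fun b => has (fun c => ~~ r a c && ~~ r b c) O)
                        (filter (r a) O)) O,
      has (fun a => ~~ pairwise r [seq y <- O | ~~ r a y]) N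
    | alpha2 && ~~ pairwise r O].
End Patterns.

(* Row [i] of [M] records the adjacency of vertex [i] to the vertices [j < i];
   the default value [false] fills the rest. *)
Definition row_adj (M : seq bitseq) : rel nat :=
  fun i j => nth false (nth [::] M i) j || nth false (nth [::] M j) i.

Definition excluded alpha2 w M S :=
  completes_pattern (row_adj (rcons M S)) alpha2 w (size M) (iota 0 (size M)).

Definition extend alpha2 w M S Ts :=
  [seq T <- flatten [seq [:: rcons T false; rcons T true] | T <- Ts]
    | ~~ excluded alpha2 w (rcons M S) T].

(* A node consists of the matrix [M] of the vertices found so far and the list
   [Ts] of the adjacency rows that any other vertex may have.  [Branch k]
   distinguishes whether a vertex with the [k]-th row exists (it is then added)
   or not (the row is then deleted).  [Leaf] lists the colours of the found
   vertices followed by those of the rows in [Ts]. *)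
Inductive search_tree :=
  | Leaf of seq nat
  | Branch of nat & search_tree & search_tree.

Definition leaf_ok alpha2 w M Ts (col : seq nat) :=
  let n := size M in
  let cv i := nth 0 col i in
  let ct k := nth 0 col (n + k) in
  let T k := nth [::] Ts k in
  [&& all (fun c => c <= w) col,
      all (fun i => all (fun j => row_adj M i j ==> (cv i != cv j)) (iota 0 n)) (iota 0 n),
      all (fun k => all (fun i => nth false (T k) i ==> (cv i != ct k)) (iota 0 n))
        (iota 0 (size Ts)) &
      all (fun k => all (fun l => (l <= k) && (ct l == ct k) ==>
            excluded alpha2 w (rcons M (T k)) (rcons (T l) true))
          (iota 0 (size Ts))) (iota 0 (size Ts))].

Fixpoint closes alpha2 w M Ts t :=
  match t with
  | Leaf col => leaf_ok alpha2 w M Ts col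
  | Branch k t1 t2 =>
    let S := nth [::] Ts k in
    closes alpha2 w (rcons M S) (extend alpha2 w M S Ts) t1
    && closes alpha2 w M [seq T <- Ts | T != S] t2
  end.

Definition root alpha2 w rows :=
  foldl (fun MT S => (rcons MT.1 S, extend alpha2 w MT.1 S MT.2))
    ([::], [:: [::]]) rows.

Definition refutes alpha2 w rows t :=
  let MT := root alpha2 w rows in closes alpha2 w MT.1 MT.2 t.

Record pattern_free (alpha2 : bool) w (X : eqType) (r : rel X) (D : {pred X}) : Prop := {
  no_codiamond : forall a b c d, a \in D -> b \in D -> c \in D -> d \in D ->
    r a b -> ~~ r a c -> ~~ r b c -> ~~ r a d -> ~~ r b d -> c != d -> r c d;
  no_K5_minus_e : forall a b c u v,
    a \in D -> b \in D -> c \in D -> u \in D -> v \in D ->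
    r a b -> r a c -> r b c -> r a u -> r b u -> r c u ->
    r a v -> r b v -> r c v -> u != v -> r u v;
  clique_size : forall s, {subset s <= D} -> pairwise r s -> size s <= w;
  no_indep3 : alpha2 -> forall a b c, a \in D -> b \in D -> c \in D ->
    b != c -> a != b -> a != c -> ~~ r a b -> ~~ r a c -> r b c }.

Section PatternSoundness.
Variables (X : eqType) (r : rel X).

Lemma pairwise_distinct (s : seq X) : uniq s ->
  {in s &, forall x y, x != y -> r x y} -> pairwise r s.
Proof.
move=> us sr; move: us; rewrite uniq_pairwise.
by apply: (sub_in_pairwise (P := [in s])) => //; apply/allP.
Qed.

Lemma has_cliqueP k (s : seq X) : has_clique r k s ->
  exists l, [/\ {subset l <= s}, size l = k & pairwise r l].
Proof.
elim: k s => [|k IH] s /=; first by exists [::].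
case/hasP=> a sa /IH [l [ls sl rl]]; exists (a :: l); split=> /=.
- move=> y; rewrite inE => /predU1P[-> //|/ls].
  by rewrite mem_filter => /andP[].
- by rewrite sl.
rewrite rl andbT; apply/allP=> y /ls.
by rewrite mem_filter => /andP[].
Qed.

Lemma completes_pattern_sound alpha2 w (D : {pred X}) x s :
  symmetric r -> irreflexive r -> pattern_free alpha2 w r D ->
  uniq (x :: s) -> {subset x :: s <= D} ->
  completes_pattern r alpha2 w x s = false.
Proof.
move=> rC r0 [cd k5 cl i3] /= /andP[xs us] sD.
have xD : x \in D by apply: sD; rewrite mem_head.
have {}sD y : y \in s -> y \in D by move=> ys; apply: sD; rewrite inE ys orbT.
have xN y : y \in s -> x != y by apply: contraTneq => <-.
apply/negP; case/or3P=> [/has_cliqueP [l [ls sl rl]]||].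
- suff: size (x :: l) <= w by rewrite /= sl ltnn.
  apply: cl => [y|/=]; rewrite ?inE.
    by case/predU1P=> [-> //|/ls]; rewrite mem_filter => /andP[_ /sD].
  by rewrite rl andbT; apply/allP=> y /ls; rewrite mem_filter => /andP[].
- case/hasP=> a; rewrite mem_filter => /andP[xa sa] /hasP[b].
  rewrite !mem_filter => /and3P[ab xb sb] /negP; apply.
  apply: pairwise_distinct; first by rewrite !filter_uniq.
  move=> u v; rewrite !mem_filter => /and4P[bu au xu su] /and4P[bv av xv sv].
  by apply: (k5 x a b) => //; apply: sD.
case/or3P.
- case/hasP=> b; rewrite mem_filter => /andP[xb sb] /hasP[a].
  rewrite !mem_filter => /and3P[ba xa sa] /hasP[c].
  rewrite !mem_filter => /and4P[ac bc xc sc] /hasP[d].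
  rewrite !mem_filter => /and4P[ad bd xd sd] cd'.
  move/negP: xb; apply; apply: (k5 a c d) => //; rewrite ?[r _ x]rC ?[r _ b]rC //;
    by [apply: sD|apply: xN].
- case/hasP=> a; rewrite mem_filter => /andP[xa sa] /hasP[b].
  rewrite !mem_filter => /and3P[ab xb sb] /hasP[c].
  rewrite mem_filter => /andP[xc sc] /andP[ac bc].
  move/negP: xc; apply; apply: (cd a b x c) => //; rewrite 1?[r _ x]rC //;
    by [apply: sD|apply: xN].
case/orP=> [/hasP[a]|/andP[al2 /negP]].
  rewrite mem_filter => /andP[xa sa] /negP; apply.
  apply: pairwise_distinct; first by rewrite !filter_uniq.
  move=> u v; rewrite !mem_filter => /and3P[au xu su] /and3P[av xv sv].
  by apply: (cd x a) => //; apply: sD.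
apply; apply: pairwise_distinct; first by rewrite filter_uniq.
move=> u v; rewrite !mem_filter => /andP[xu su] /andP[xv sv] uv.
by apply: (i3 al2 x) => //; first [exact: sD | exact: xN].
Qed.

End PatternSoundness.

Lemma pattern_free_inj alpha2 w (X Y : eqType) (r : rel X) (q : rel Y)
    (C : {pred X}) (D : {pred Y}) (f : X -> Y) :
  {in C, forall i, f i \in D} -> {in C &, injective f} ->
  {in C &, forall i j, r i j = q (f i) (f j)} ->
  pattern_free alpha2 w q D -> pattern_free alpha2 w r C.
Proof.
move=> fD finj rq [cd k5 cl i3].
have neq i j : i \in C -> j \in C -> i != j -> f i != f j.
  by move=> Ci Cj; apply: contra_neq; apply: finj.
split.
- move=> a b c d Ca Cb Cc Cd; rewrite !rq // => ? ? ? ? ? ?.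
  by apply: (cd (f a) (f b)) => //; first [exact: fD | exact: neq].
- move=> a b c u v Ca Cb Cc Cu Cv; rewrite !rq // => ? ? ? ? ? ? ? ? ? ?.
  by apply: (k5 (f a) (f b) (f c)) => //; first [exact: fD | exact: neq].
- move=> s sC rs; rewrite -(size_map f); apply: cl.
    by move=> y /mapP[i /sC /fD ? ->].
  rewrite pairwise_map; apply: (sub_in_pairwise (P := C)) rs; last exact/allP.
  by move=> i j Ci Cj; rewrite /= rq.
move=> al2 a b c Ca Cb Cc; rewrite !rq // => ? ? ? ? ?.
by apply: (i3 al2 (f a)) => //; first [exact: fD | exact: neq].
Qed.

Section SearchSoundness.
Variable G : sgraph.

Definition colorable_on (A : {set G}) k := exists c : G -> nat,
  {in A, forall x, c x < k} /\ {in A &, forall x y, adj x y -> c x != c y}.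

Variables (A : {set G}) (alpha2 : bool) (w : nat).
Hypothesis pfA : pattern_free alpha2 w (@adj G) [in A].

Definition row (s : seq G) (x : G) : bitseq := [seq adj x u | u <- s].

Fixpoint rows_from p s :=
  if s is x :: s' then row p x :: rows_from (rcons p x) s' else [::].

Definition models (M : seq bitseq) (s : seq G) :=
  [/\ size M = size s, forall i, size (nth [::] M i) <= i &
      forall x0 i j, i < size s -> j < size s ->
        row_adj M i j = adj (nth x0 s i) (nth x0 s j)].

Lemma models_rcons M s x : models M s -> models (rcons M (row s x)) (rcons s x).
Proof.
case=> szM szr Ms; split=> [|i|x0 i j]; rewrite ?size_rcons ?szM //.
  rewrite nth_rcons szM; case: ltngtP => // ->; by rewrite size_map.
have nthS k : k < size s -> nth false (row s x) k = adj x (nth x0 s k).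
  by move=> ks; rewrite (nth_map x0).
have old k : k < size s -> nth false (nth [::] M k) (size s) = false.
  by move=> ks; rewrite nth_default // (leq_trans (szr k)) // ltnW.
rewrite !ltnS /row_adj !nth_rcons szM.
case: (ltngtP i) => // [is_|->] _; case: (ltngtP j) => // [js|->] _.
- exact: Ms.
- by rewrite old // nthS //= adj_sym.
- by rewrite old // nthS //= orbF.
by rewrite nth_default ?size_map // adj_irrefl.
Qed.

Lemma excluded_false M s x : models M s -> uniq (rcons s x) ->
  {subset rcons s x <= A} -> excluded alpha2 w M (row s x) = false.
Proof.
move=> Ms us sA; have [szM' _ M'] := models_rcons x Ms.
have szM : size M = size s by case: Ms.
have r0 : irreflexive (row_adj (rcons M (row s x))).
  case: (models_rcons x Ms) => _ szr _ i.
  by rewrite /row_adj orbb nth_default.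
rewrite /excluded; apply: (completes_pattern_sound (D := [in iota 0 (size s).+1])).
- by move=> i j; rewrite /row_adj orbC.
- exact: r0.
- apply: (pattern_free_inj (f := nth x (rcons s x)) (D := [in A])) pfA.
  + move=> i; rewrite mem_iota /= add0n -(size_rcons s x) => ?.
    by apply: sA; apply: mem_nth.
  + move=> i j; rewrite !mem_iota /= !add0n -(size_rcons s x) => ? ? /eqP.
    by rewrite nth_uniq // => /eqP.
  + move=> i j; rewrite !mem_iota /= !add0n -(size_rcons s x) => ? ?.
    exact: M'.
- by rewrite szM /= mem_iota ltnn iota_uniq.
by move=> i; rewrite szM inE !mem_iota /= add0n ltnS; case: ltngtP.
Qed.

Definition covers M (Ts : seq bitseq) s :=
  [/\ uniq s, {subset s <= A}, models M s &
      {in A, forall x, x \notin s -> row s x \in Ts}].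

Lemma covers_nil : covers [::] [:: [::]] [::].
Proof. by split=> //; split=> // i; rewrite nth_nil. Qed.

Lemma covers_rcons M Ts s x : x \in A -> x \notin s -> covers M Ts s ->
  covers (rcons M (row s x)) (extend alpha2 w M (row s x) Ts) (rcons s x).
Proof.
move=> xA xs [us sA Ms sT].
have us' : uniq (rcons s x) by rewrite rcons_uniq xs.
have sA' : {subset rcons s x <= A}.
  by move=> y; rewrite mem_rcons inE => /predU1P[-> //|/sA].
split=> //; first exact: models_rcons.
move=> y yA ys'; rewrite mem_filter excluded_false //; first last.
- by move=> z; rewrite mem_rcons inE => /predU1P[-> //|/sA'].
- by rewrite rcons_uniq ys'.
- exact: models_rcons.
have ys : y \notin s by apply: contra ys'; rewrite mem_rcons inE orbC => ->.
apply/flatten_mapP; exists (row s y); first exact: sT.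
by rewrite /row map_rcons !inE; case: (adj y x); rewrite eqxx ?orbT.
Qed.

Lemma leaf_ok_sound M Ts s col : covers M Ts s -> leaf_ok alpha2 w M Ts col ->
  colorable_on A w.+1.
Proof.
move=> [us sA Ms sT] /and4P[/allP colw /allP cvv /allP cvt /allP ctt].
have [szM _ adjM] := Ms.
pose c x := if x \in s then nth 0 col (index x s)
            else nth 0 col (size M + index (row s x) Ts).
have iotaT x : x \in A -> x \notin s -> index (row s x) Ts \in iota 0 (size Ts).
  by move=> xA xs; rewrite mem_iota /= index_mem sT.
have iotaS x : x \in s -> index x s \in iota 0 (size M).
  by move=> xs; rewrite mem_iota /= szM index_mem.
have vt x y : x \in A -> y \in A -> x \in s -> y \notin s -> adj y x -> c x != c y.
  move=> xA yA xs ys xy; rewrite /c xs (negPf ys).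
  have /allP/(_ _ (iotaS _ xs))/implyP := cvt _ (iotaT _ yA ys); apply.
  by rewrite nth_index ?sT // (nth_map x) ?index_mem // nth_index.
have tt x y : x \in A -> y \in A -> x \notin s -> y \notin s -> adj x y ->
    index (row s y) Ts <= index (row s x) Ts -> c x != c y.
  move=> xA yA xs ys xy le; rewrite /c (negPf xs) (negPf ys).
  have /allP/(_ _ (iotaT _ yA ys)) := ctt _ (iotaT _ xA xs).
  rewrite le /=; case: eqVneq => [_ /=|]; last by rewrite eq_sym.
  rewrite !nth_index ?sT //.
  have -> : rcons (row s y) true = row (rcons s x) y.
    by rewrite /row map_rcons adj_sym xy.
  rewrite excluded_false //; first exact: models_rcons.
    rewrite !rcons_uniq us xs mem_rcons inE (negPf ys) !andbT orbF.
    by apply: contraTneq xy => ->; rewrite adj_irrefl.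
  move=> z; rewrite mem_rcons inE => /predU1P[-> //|].
  by rewrite mem_rcons inE => /predU1P[-> //|/sA].
exists c; split=> [x xA|x y xA yA xy].
  have c0 n : nth 0 col n <= w.
    case: (ltnP n (size col)) => [lt|ge]; last by rewrite nth_default.
    by apply: colw; apply: mem_nth.
  by rewrite /c ltnS; case: ifP.
case: (boolP (x \in s)) (boolP (y \in s)) => [xs|xs] [ys|ys].
- rewrite /c xs ys.
  have /allP/(_ _ (iotaS _ ys))/implyP := cvv _ (iotaS _ xs); apply.
  by rewrite (adjM x) ?index_mem // !nth_index.
- by apply: vt => //; rewrite adj_sym.
- by rewrite eq_sym vt.
case: (leqP (index (row s y) Ts) (index (row s x) Ts)) => [|/ltnW] le.
  exact: tt.
by rewrite eq_sym tt // adj_sym.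
Qed.

Lemma closes_sound t M Ts s : covers M Ts s -> closes alpha2 w M Ts t ->
  colorable_on A w.+1.
Proof.
elim: t M Ts s => [col|k t1 IH1 t2 IH2] M Ts s cov /=; first exact: leaf_ok_sound cov.
set S := nth _ _ _ => /andP[cl1 cl2].
case: (boolP [exists x in A, (x \notin s) && (row s x == S)]).
  case/exists_inP=> x xA /andP[xs /eqP xS]; rewrite -xS in cl1.
  by apply: (IH1 _ _ (rcons s x)) cl1; apply: covers_rcons.
rewrite negb_exists_in => /forall_inP noS.
apply: (IH2 _ _ s) cl2; case: cov => us sA Ms sT; split=> // x xA xs.
by rewrite mem_filter sT // andbT; have := noS x xA; rewrite xs.
Qed.

Lemma refutes_sound s t : uniq s -> {subset s <= A} ->
  refutes alpha2 w (rows_from [::] s) t -> colorable_on A w.+1.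
Proof.
rewrite /refutes /root => us sA.
suff gen p M Ts : covers M Ts p -> uniq (p ++ s) -> {subset p ++ s <= A} ->
    let MT := foldl (fun MT S => (rcons MT.1 S, extend alpha2 w MT.1 S MT.2))
      (M, Ts) (rows_from p s) in
    closes alpha2 w MT.1 MT.2 t -> colorable_on A w.+1.
  by apply: (gen [::]) => //; apply: covers_nil.
elim: s p M Ts {us sA} => [|x s IH] p M Ts cov /=; first by move=> _ _; apply: closes_sound cov.
rewrite -cat_rcons => us sA; apply: (IH (rcons p x)) => //.
move: us; rewrite cat_uniq rcons_uniq => /andP[/andP[xp _] _].
by apply: covers_rcons => //; apply: sA; rewrite mem_cat mem_rcons mem_head.
Qed.

End SearchSoundness.

(* The search trees were found by a randomised greedy search outside Rocq. *)
Definition K1_tree :=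
Leaf [:: 0; 0].

Lemma K1_tree_refutes : refutes false 1
  [:: [::]]
  K1_tree.
Proof. by vm_compute. Qed.

Definition K2_tree :=
Branch 0
   (Leaf [:: 0; 1; 0; 2; 0; 2; 1; 1])
   (Leaf [:: 0; 1; 0; 1]).

Lemma K2_tree_refutes : refutes false 2
  [:: [::];
      [:: true]]
  K2_tree.
Proof. by vm_compute. Qed.

Definition sun_tree :=
Branch 5
   (Branch 4
    (Leaf [:: 0; 0; 0; 2; 3; 1; 1; 3; 2; 2; 2; 2; 2; 2; 2])
    (Leaf [:: 1; 0; 2; 1; 0; 2; 0; 1; 1; 1; 1; 3; 0; 2; 3; 2; 2; 2; 3; 3; 3; 3]))
   (Branch 2
    (Branch 15
     (Leaf [:: 0; 0; 0; 3; 2; 1; 1; 1; 2; 3; 2; 2; 2; 2; 3; 2; 2; 2])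
     (Leaf [:: 0; 1; 2; 0; 1; 2; 0; 0; 0; 3; 1; 1; 1; 1; 1; 2; 3; 2; 2; 2; 3; 3; 3]))
    (Branch 7
     (Branch 11
      (Leaf [:: 2; 0; 1; 2; 0; 1; 0; 1; 2; 2; 2; 2; 2; 2; 2; 0; 0; 0; 1; 1; 1; 1; 3])
      (Branch 14
       (Leaf [:: 1; 1; 1; 3; 2; 0; 2; 0; 3; 3; 2; 2; 2; 3; 3])
       (Leaf [:: 1; 0; 2; 1; 0; 2; 0; 1; 1; 1; 1; 0; 3; 0; 0; 2; 2; 2; 2; 2; 3; 3])))
     (Branch 14
      (Leaf [:: 0; 0; 0; 1; 2; 3; 1; 2; 2; 3; 2; 1; 2; 3; 2; 2; 1; 2; 2; 2; 1; 2; 3; 2])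
      (Branch 0
       (Leaf [:: 0; 1; 2; 0; 3; 2; 0; 0; 3; 1; 1; 1; 2; 3; 2; 2; 2; 3; 3; 3])
       (Branch 7
        (Leaf [:: 0; 0; 0; 2; 1; 3; 1; 1; 3; 2; 2; 3; 3; 2; 3; 3; 3; 1; 3])
        (Branch 10
         (Leaf [:: 1; 1; 1; 3; 0; 2; 0; 3; 3; 2; 3; 2; 2; 2; 2; 2; 2; 2; 3; 2])
         (Branch 0
          (Leaf [:: 0; 1; 3; 0; 2; 3; 0; 0; 2; 1; 1; 1; 3; 3; 2; 2; 3; 3; 2; 2])
          (Branch 5
           (Leaf [:: 0; 2; 1; 0; 3; 1; 1; 0; 3; 2; 2; 2; 1; 3; 3])
           (Branch 3
            (Leaf [:: 0; 0; 0; 1; 3; 2; 1; 2; 2; 3; 2; 2; 1; 3; 2; 2])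
            (Branch 0
             (Leaf [:: 0; 1; 2; 0; 1; 2; 0; 0; 3; 1; 1; 1; 2; 2; 2; 2; 2; 3; 3])
             (Leaf [:: 1; 1; 1; 0; 3; 2; 3; 0; 3; 2; 2; 2; 0; 3]))))))))))).

Lemma sun_tree_refutes : refutes false 3
  [:: [::];
      [:: false];
      [:: false; false];
      [:: false; true; true];
      [:: true; false; true; true];
      [:: true; true; false; true; true]]
  sun_tree.
Proof. by vm_compute. Qed.

Definition K3_tree :=
Branch 1
   (Branch 1
    (Leaf [:: 0; 1; 2; 0; 1; 3; 3; 3; 2; 2; 2; 2])
    (Branch 0
     (Leaf [:: 0; 1; 3; 0; 1; 2; 2; 2; 2; 2; 3; 2])
     (Branch 0
      (Branch 3
       (Leaf [:: 1; 0; 2; 0; 1; 3; 2; 2; 3; 2; 3; 2; 2; 2])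
       (Leaf [:: 0; 1; 2; 1; 0; 2; 3; 3; 3; 2; 2]))
      (Branch 1
       (Leaf [:: 0; 1; 2; 0; 1; 3; 3; 2; 3; 2; 2])
       (Leaf [:: 0; 1; 2; 3; 0; 1; 2; 2])))))
   (Branch 1
    (Branch 0
     (Leaf [:: 0; 3; 1; 0; 1; 2; 2; 2; 2; 3; 2; 2])
     (Branch 2
      (Leaf [:: 2; 1; 0; 0; 1; 2; 2; 2; 3; 3; 3; 3])
      (Leaf [:: 1; 0; 2; 2; 1; 1; 0; 0; 3])))
    (Branch 0
     (Branch 0
      (Leaf [:: 0; 1; 3; 0; 1; 2; 2; 2; 2; 2])
      (Branch 1
       (Leaf [:: 0; 1; 3; 3; 1; 0; 0; 2; 2; 2])
       (Leaf [:: 0; 1; 2; 3; 0; 1; 2])))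
     (Branch 1
      (Leaf [:: 0; 1; 2; 2; 0; 0; 1; 1; 3])
      (Leaf [:: 0; 1; 2; 0; 1; 2])))).

Lemma K3_tree_refutes : refutes true 3
  [:: [::];
      [:: true];
      [:: true; true]]
  K3_tree.
Proof. by vm_compute. Qed.

Definition K4_tree :=
Branch 2
   (Leaf [:: 3; 4; 2; 1; 0; 0; 1; 3; 3; 3; 2; 2; 3; 2; 2; 4; 2; 2])
   (Branch 4
    (Leaf [:: 1; 2; 4; 3; 0; 0; 1; 3; 2; 2; 2; 3; 4; 3; 3; 2; 2])
    (Branch 1
     (Leaf [:: 3; 1; 4; 2; 0; 0; 1; 3; 3; 3; 2; 2; 4; 2; 2; 2])
     (Branch 5
      (Leaf [:: 2; 4; 3; 1; 0; 0; 1; 3; 2; 2; 2; 2; 3; 3; 4])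
      (Branch 0
       (Leaf [:: 3; 4; 1; 2; 0; 0; 1; 3; 4; 3; 3; 2; 4; 2; 2; 2])
       (Leaf [:: 1; 2; 3; 4; 0; 0; 1; 1; 1; 4; 3; 2; 3; 3]))))).

Lemma K4_tree_refutes : refutes true 4
  [:: [::];
      [:: true];
      [:: true; true];
      [:: true; true; true];
      [:: true; true; false; false];
      [:: false; false; true; true; false]]
  K4_tree.
Proof. by vm_compute. Qed.

(** * Forbidden induced subgraphs *)

Lemma free_embedding (G H : sgraph) Hs (g : H -> G) :
  free Hs G -> List.In H Hs -> injective g ->
  {mono g : x y / adj x y} -> False.
Proof.
move=> fG HHs gI gM; apply: (fG H HHs).
pose S := [set g x | x : H]; exists S.
have mem (u : induced S) : exists x, g x == val u.
  by case: u => u /= /imsetP[x _ ->]; exists x.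
have fS x : g x \in S by apply: imset_f.
exists (fun u => xchoose (mem u)); split; last first.
  by move=> u v; rewrite -gM !(eqP (xchooseP (mem _))).
exists (fun x => exist _ (g x) (fS x)) => [u|x].
  by apply: val_inj => /=; rewrite (eqP (xchooseP (mem u))).
by apply: gI; rewrite (eqP (xchooseP (mem _))).
Qed.

Lemma set2_eq (T : finType) (x y u v : T) : u != v ->
  ([set x; y] == [set u; v]) = (x == u) && (y == v) || (x == v) && (y == u).
Proof.
move=> uv; apply/eqP/idP=> [E|].
  have : v \in [set x; y] by rewrite E set22.
  have : u \in [set x; y] by rewrite E set21.
  move: uv; rewrite !inE; case/boolP: (u == x) => [/eqP <-|_] uv /=.
    by rewrite [v == u]eq_sym (negPf uv) eqxx /= eq_sym => _ ->.
  by move=> /eqP <-; rewrite [v == u]eq_sym (negPf uv) orbF eq_sym => ->; rewrite eqxx orbT.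
by case/orP=> /andP[/eqP -> /eqP ->] //; rewrite setUC.
Qed.

Section PatternsOfFree.
Variable G : sgraph.
Hypothesis hG : free [:: K5_minus_e; K2_cup_2K1] G.

Lemma free_no_K5_minus_e (a b c u v : G) :
  adj a b -> adj a c -> adj b c -> adj a u -> adj b u -> adj c u ->
  adj a v -> adj b v -> adj c v -> u != v -> adj u v.
Proof.
move=> ab ac bc au bu cu av bv cv uv; apply: contraT => nuv.
have neq x y : adj x y -> (x == y) = false :> bool.
  by move=> xy; apply: contraTF xy => /eqP ->; rewrite adj_irrefl.
pose g (i : K5_minus_e) := nth u [:: u; a; b; c; v] (i : 'I_5).
have gI : injective g.
  move=> i j /eqP; rewrite nth_uniq //; first by move/eqP/val_inj.
  rewrite /= !inE !negb_or uv !(eq_sym u).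
  by rewrite !neq.
exfalso; apply: (free_embedding hG _ gI); first by left.
case=> [[|[|[|[|[|i]]]]] hi] // [[|[|[|[|[|j]]]]] hj] //=;
  rewrite /delete_edge_adj /= /complete_adj ?set2_eq // -?val_eqE /= /g /=
    ?adj_irrefl ?ab ?ac ?bc ?au ?bu ?cu ?av ?bv ?cv ?(negPf nuv) //;
  by rewrite adj_sym ?ab ?ac ?bc ?au ?bu ?cu ?av ?bv ?cv ?(negPf nuv).
Qed.

Lemma free_no_codiamond (a b c d : G) :
  adj a b -> ~~ adj a c -> ~~ adj b c -> ~~ adj a d -> ~~ adj b d ->
  c != d -> adj c d.
Proof.
move=> ab nac nbc nad nbd cd; apply: contraT => ncd.
have neq x y z : adj x y -> ~~ adj z y -> (x == z) = false :> bool.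
  by move=> xy; apply: contraNF => /eqP <-.
have ba : adj b a by rewrite adj_sym.
pose g (i : K2_cup_2K1) := match i with
  | inl i => nth a [:: a; b] (i : 'I_2) | inr (inl _) => c | inr (inr _) => d end.
have abn : (a == b) = false by apply: contraTF ab => /eqP ->; rewrite adj_irrefl.
have ac : (a == c) = false by apply: neq ab _; rewrite adj_sym.
have ad : (a == d) = false by apply: neq ab _; rewrite adj_sym.
have bc : (b == c) = false by apply: neq ba _; rewrite adj_sym.
have bd : (b == d) = false by apply: neq ba _; rewrite adj_sym.
have one (i j : 'I_1) : i = j by rewrite !ord1.
exfalso; apply: (free_embedding hG _ (g := g)); first by right; left.
  case=> [[[|[|i]] hi]|[i|i]] // [[[|[|j]] hj]|[j|j]] //= /eqP;
    rewrite ?abn ?[b == a]eq_sym ?abn ?[c == _]eq_sym ?[d == _]eq_sym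
      ?ac ?ad ?bc ?bd ?(negPf cd) ?[d == c]eq_sym ?(negPf cd) // => _;
    rewrite ?(one i j) //; by congr inl; apply: val_inj.
case=> [[[|[|i]] hi]|[i|i]] // [[[|[|j]] hj]|[j|j]] //=;
  rewrite /complete_adj -?val_eqE /= ?adj_irrefl ?ab ?ba //
    ?(negPf nac) ?(negPf nad) ?(negPf nbc) ?(negPf nbd) ?(negPf ncd)
    ?(one i j) ?eqxx //;
  by rewrite adj_sym ?(negPf nac) ?(negPf nad) ?(negPf nbc) ?(negPf nbd) ?(negPf ncd).
Qed.

End PatternsOfFree.

(** * Colouring *)

Lemma greedy_matching (T : finType) (e : rel T) (K L : {set T}) d :
  #|L| <= d -> {in L, forall x, d <= #|[set k in K | e x k]|} ->
  exists2 f : T -> T, {in L &, injective f} &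
    {in L, forall x, f x \in K /\ e x (f x)}.
Proof.
elim: {L}#|L| {-2}L (erefl #|L|) => [|n IH] L cL.
  move/cards0_eq: cL => -> _ _; exists id => x; last by rewrite inE.
  by move=> y; rewrite inE.
move=> nd deg; have /card_gt0P[x xL] : 0 < #|L| by rewrite cL.
have cLx : #|L :\ x| = n by move: cL; rewrite (cardsD1 x) xL => -[].
have [||f fI fK] := IH _ cLx; first by rewrite cLx ltnW // -cL.
  by move=> y /setD1P[_]; apply: deg.
have : 0 < #|[set k in K | e x k] :\: f @: (L :\ x)|.
  rewrite cardsD subn_gt0 (leq_ltn_trans (subset_leq_card (subsetIr _ _))) //.
  by rewrite (leq_ltn_trans (leq_imset_card _ _)) // cLx -ltnS -cL ltnS
    (leq_trans nd) ?deg.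
case/card_gt0P=> k; rewrite !inE => /and3P[kf kK ek].
exists (fun y => if y == x then k else f y) => [y z yL zL|y yL].
  case: eqVneq => [->|yx]; case: eqVneq => [->|zx] // E.
  - by case/negP: kf; rewrite E; apply/imset_f/setD1P.
  - by case/negP: kf; rewrite -E; apply/imset_f/setD1P.
  by apply: fI => //; apply/setD1P.
by case: eqVneq => [->|yx]; [split|apply: fK; apply/setD1P].
Qed.

Section Coloring.
Variable G : sgraph.
Implicit Types (A B I K L : {set G}) (x y : G).

Lemma cliqueP A : reflect {in A &, forall x y, x != y -> adj x y} (clique A).
Proof.
apply: (iffP forall_inP) => [h x y xA yA xy|h x xA].
  by have /forall_inP/(_ y yA)/implyP := h x xA; apply.
by apply/forall_inP=> y yA; apply/implyP; apply: h.
Qed.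

Lemma clique_setU1 K x : clique K -> {in K, forall k, adj x k} -> clique (x |: K).
Proof.
move=> /cliqueP cK xK; apply/cliqueP => y z /setU1P[->|yK] /setU1P[->|zK].
- by rewrite eqxx.
- by move=> _; apply: xK.
- by move=> _; rewrite adj_sym xK.
exact: cK.
Qed.

Lemma colorable_onW A k l : k <= l -> colorable_on A k -> colorable_on A l.
Proof. by move=> kl [c [ck cA]]; exists c; split=> // x /ck /leq_trans->. Qed.

Lemma colorable_on_indep A I k : {in I &, forall x y, ~~ adj x y} ->
  colorable_on (A :\: I) k -> colorable_on A k.+1.
Proof.
move=> I0 [c [ck cA]]; exists (fun x => if x \in I then k else c x).
have D x : x \in A -> x \notin I -> x \in A :\: I by move=> ? ?; apply/setDP.
split=> [x xA|x y xA yA xy].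
  by case: ifPn => // xI; rewrite ltnW // ltnS ck // D.
case: ifPn => xI; case: ifPn => yI.
- by case/negP: (I0 x y xI yI).
- by rewrite eq_sym ltn_eqF // ck // D.
- by rewrite ltn_eqF // ck // D.
by apply: cA => //; apply: D.
Qed.

Lemma colorable_matching K L x f : clique K ->
  {in L :\ x &, injective f} ->
  {in L :\ x, forall y, f y \in K /\ ~~ adj y (f y)} ->
  [disjoint K & L] ->
  colorable_on (K :|: L) #|K|.+1.
Proof.
move=> /cliqueP cK fI fK dKL.
pose rk k := index k (enum K).
have rkK k : k \in K -> rk k < #|K|.
  by move=> kK; rewrite cardE index_mem mem_enum.
have rkI : {in K &, injective rk}.
  move=> k l kK lK E.
  by rewrite -[k](nth_index k (s := enum K)) ?mem_enum // -/(rk k) E nth_index ?mem_enum.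
have inL y : y \in K :|: L -> y \notin K -> y != x -> y \in L :\ x.
  by rewrite !inE => /orP[->|-> _ ->].
pose g y := if y \in K then y else f y.
have gK y : y \in K :|: L -> (y \in K) || (y != x) -> g y \in K.
  move=> yA; rewrite /g; case: ifPn => //= yK yx.
  by case: (fK y); first exact: inL.
have gadj y z : y \in K :|: L -> z \in K :|: L -> (y \in K) || (y != x) ->
    (z \in K) || (z != x) -> adj y z -> g y != g z.
  move=> yA zA; rewrite /g.
  case: ifPn => [yK _|yK /= yx]; case: ifPn => [zK _|zK /= zx] yz.
  - by apply: contraTneq yz => ->; rewrite adj_irrefl.
  - have [_] := fK z (inL z zA zK zx).
    by apply: contraNneq => <-; rewrite adj_sym.
  - have [_] := fK y (inL y yA yK yx).
    by apply: contraNneq => ->.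
  apply: contraTneq yz => /fI -> //; rewrite ?adj_irrefl //; exact: inL.
exists (fun y => if (y \in K) || (y != x) then rk (g y) else #|K|).
split=> [y yA|y z yA zA yz].
  by case: ifP => // yx; rewrite ltnS ltnW // rkK // gK.
have yz' : y != z by apply: contraTneq yz => ->; rewrite adj_irrefl.
case: ifPn => yx; case: ifPn => zx.
- by apply: contraNneq (gadj y z yA zA yx zx yz) => /rkI ->; rewrite ?gK.
- by rewrite ltn_eqF // rkK // gK.
- by rewrite eq_sym ltn_eqF // rkK // gK.
move: yx zx yz'; rewrite !negb_or !negbK => /andP[_ /eqP ->] /andP[_ /eqP ->].
by rewrite eqxx.
Qed.

Lemma cobipartite_colorable K L : clique K -> clique L -> [disjoint K & L] ->
  1 < #|K| -> (forall B, B \subset K :|: L -> clique B -> #|B| <= #|K|) ->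
  {in L, forall x, #|[set k in K | adj x k]| <= 2} ->
  colorable_on (K :|: L) #|K|.+1.
Proof.
move=> cK cL dKL K2 om deg.
pose N x := [set k in K | adj x k].
have degC x : x \in L -> #|K| - 2 <= #|[set k in K | ~~ adj x k]|.
  move=> xL; have := cardsID (N x) K.
  have -> : K :&: N x = N x by apply/setIidPr/subsetP=> k; rewrite inE => /andP[].
  have -> : K :\: N x = [set k in K | ~~ adj x k].
    by apply/setP=> k; rewrite !inE; case: (k \in K); rewrite ?andbF ?andbT.
  by move=> <-; rewrite leq_subLR leq_add2r deg.
have leLK : #|L| <= #|K| by apply: om; rewrite ?subsetUr.
have dK2 : #|K| = (#|K| - 2).+2 by rewrite -addn2 subnK.
have [-> /= | [x0 x0L]] := set_0Vmem L.
  rewrite setU0; apply: (colorable_onW (leqnSn #|K|)).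
  exists (fun k => index k (enum K)); split=> [k kK|k l kK lK kl].
    by rewrite cardE index_mem mem_enum.
  apply: contraTneq kl => /(congr1 (nth k (enum K))).
  by rewrite !nth_index ?mem_enum // => ->; rewrite adj_irrefl.
suff [x [f [xL fI fK]]] : exists x, exists f, [/\ x \in L,
    {in L :\ x &, injective f} &
    {in L :\ x, forall y, f y \in K /\ ~~ adj y (f y)}].
  exact: colorable_matching fI fK _.
move: leLK; rewrite leq_eqVlt => /predU1P[cLK|ltLK]; last first.
  have [||f fI fK] := @greedy_matching _ (fun x k => ~~ adj x k) K (L :\ x0) (#|K| - 2).
  - by rewrite -ltnS -ltnS -dK2; move: ltLK; rewrite (cardsD1 x0 L) x0L.
  - by move=> y /setD1P[_]; apply: degC.
  by exists x0, f.
have /existsP[x /existsP[x' /and4P[xL x'L xx' NN]]] :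
  [exists x, exists x', [&& x \in L, x' \in L, x != x' & ~~ ((N x == N x') && (#|N x| == 2))]].
  apply: contraT; rewrite negb_exists => /forallP noxx.
  have same x x' : x \in L -> x' \in L -> x != x' -> N x = N x' /\ #|N x| = 2.
    move=> xL x'L xx'; have := noxx x; rewrite negb_exists => /forallP/(_ x').
    by rewrite xL x'L xx' /= negbK => /andP[/eqP -> /eqP ->].
  have /card_gt1P[x [y [xL yL xy]]] : 1 < #|L| by rewrite cLK.
  have [_ Nx2] := same x y xL yL xy.
  have sub : N x \subset K by apply/subsetP=> k; rewrite inE => /andP[].
  have cl : clique (N x :|: L).
    have NL z k : z \in L -> k \in N x -> adj z k.
      move=> zL; have [->|xz] := eqVneq x z; first by rewrite inE => /andP[].
      by have [-> _] := same x z xL zL xz; rewrite inE => /andP[].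
    apply/cliqueP=> u v /setUP[uN|uL] /setUP[vN|vL] uv.
    - by move/cliqueP: cK; apply => //; apply: (subsetP sub).
    - by rewrite adj_sym NL.
    - exact: NL.
    by move/cliqueP: cL; apply.
  have := om _ (setSU _ sub) cl; rewrite cardsU.
  have -> : N x :&: L = set0.
    by apply/eqP; rewrite setI_eq0; apply: disjointWl sub dKL.
  by rewrite cards0 subn0 Nx2 cLK ltnNge leqnSn.
pose L0 := L :\ x :\ x'.
have cL0 : #|L0| = #|K| - 2.
  by rewrite -cLK (cardsD1 x L) xL (cardsD1 x' (L :\ x)) !inE [x' == x]eq_sym xx' x'L
    !add1n !subSS subn0.
have [||f fI fK] := @greedy_matching _ (fun x k => ~~ adj x k) K L0 (#|K| - 2).
- by rewrite cL0.
- by move=> y /setD1P[_ /setD1P[_]]; apply: degC.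
pose R := K :\: f @: L0.
have cR : #|R| = 2.
  rewrite cardsD; have -> : K :&: f @: L0 = f @: L0.
    by apply/setIidPr/subsetP=> k /imsetP[y /fK[yK _] ->].
  by rewrite card_in_imset // cL0 subKn.
(* the vertex [y] is matched to the leftover [r], and [z] gets the extra colour *)
have finish y z r : y \in L -> z \in L -> y != z -> L0 = L :\ y :\ z ->
    r \in R -> ~~ adj y r -> exists x, exists f, [/\ x \in L,
    {in L :\ x &, injective f} & {in L :\ x, forall y, f y \in K /\ ~~ adj y (f y)}].
  move=> yL zL yz L0E /setDP[rK rf] nyr.
  have in0 u : u \in L :\ z -> u != y -> u \in L0.
    by rewrite L0E !inE => /andP[-> ->] ->.
  exists z, (fun u => if u == y then r else f u); split=> // [u v uL vL|u uL].
    case: eqVneq => [->|uy]; case: eqVneq => [->|vy] // E.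
    - by case/negP: rf; rewrite E; apply/imset_f/in0.
    - by case/negP: rf; rewrite -E; apply/imset_f/in0.
    by apply: fI => //; apply: in0.
  by case: eqVneq => [->|uy] //; apply: fK; apply: in0.
have [/exists_inP[r rR nr]|] := boolP [exists r in R, ~~ adj x r].
  exact: (finish x x' r).
have [/exists_inP[r rR nr]|] := boolP [exists r in R, ~~ adj x' r].
  move=> _; apply: (finish x' x r) => //; first by rewrite eq_sym.
  by apply/setP=> u; rewrite !inE andbCA.
have RN y : y \in L -> ~~ [exists r in R, ~~ adj y r] -> R = N y.
  move=> yL; rewrite negb_exists_in => /forall_inP h.
  apply/eqP; rewrite eqEcard cR deg // andbT; apply/subsetP=> r rR.
  by rewrite inE; have := h r rR; rewrite negbK => ->; case/setDP: rR => ->.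
move=> /(RN x' x'L) E' /(RN x xL) E.
by move: NN; rewrite -E -E' eqxx cR.
Qed.

Hypothesis codiamond_free : forall a b c d : G,
  adj a b -> ~~ adj a c -> ~~ adj b c -> ~~ adj a d -> ~~ adj b d ->
  c != d -> adj c d.
Hypothesis K5_minus_e_free : forall a b c u v : G,
  adj a b -> adj a c -> adj b c -> adj a u -> adj b u -> adj c u ->
  adj a v -> adj b v -> adj c v -> u != v -> adj u v.

Definition omega_le A w := forall B, B \subset A -> clique B -> #|B| <= w.

Definition indep_le2 A := forall a b c, a \in A -> b \in A -> c \in A ->
  b != c -> a != b -> a != c -> ~~ adj a b -> ~~ adj a c -> adj b c.

Lemma pattern_freeT (alpha2 : bool) w A : omega_le A w -> (alpha2 -> indep_le2 A) ->
  pattern_free alpha2 w (@adj G) [in A].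
Proof.
move=> om al; split=> //.
- by move=> a b c d _ _ _ _; apply: codiamond_free.
- by move=> a b c u v _ _ _ _ _; apply: K5_minus_e_free.
move=> s sA ps.
have us : uniq s.
  rewrite uniq_pairwise; apply: sub_pairwise ps => x y /=.
  by apply: contraTneq => ->; rewrite adj_irrefl.
rewrite -(card_uniqP us) -cardsE; apply: om.
  by apply/subsetP=> x; rewrite inE => /sA.
elim: s {sA us} ps => [_|x s IH /= /andP[/allP xs ps]].
  by apply/cliqueP=> x y; rewrite inE.
by rewrite set_cons clique_setU1 ?IH // => y; rewrite inE => /xs.
Qed.

Lemma neighbours_in_clique_le2 A K x : omega_le A #|K| -> K \subset A ->
  clique K -> x \in A -> x \notin K -> #|[set k in K | adj x k]| <= 2.
Proof.
move=> om KA cK xA xK; rewrite leqNgt; apply/negP.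
case/card_gt2P=> a [b [c []]]; rewrite !inE.
move=> [/andP[aK xa] /andP[bK xb] /andP[cKK xc]] [ab bc ca].
have [/forall_inP xall|] := boolP [forall k in K, adj x k].
  have := om (x |: K); rewrite subUset sub1set xA KA clique_setU1 // cardsU1 xK.
  by rewrite add1n ltnn => /(_ isT isT).
rewrite negb_forall_in => /exists_inP[v vK nxv].
have adjK : {in K &, forall y z, y != z -> adj y z} by apply/cliqueP.
have vN y : adj x y -> v != y by apply: contraTneq => <-.
have ac : a != c by rewrite eq_sym.
have xv : x != v by apply: contraNneq xK => ->.
case/negP: nxv; apply: (K5_minus_e_free (a := a) (b := b) (c := c)) => //;
  by [rewrite adj_sym | apply: adjK => //; rewrite eq_sym; apply: vN | apply: adjK].
Qed.

Lemma colorable_indep3 A w a b c : 2 < w -> omega_le A w ->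
  (forall B, omega_le B w.-1 -> colorable_on B w) ->
  a \in A -> b \in A -> c \in A -> b != c -> a != b -> a != c ->
  ~~ adj a b -> ~~ adj a c -> ~~ adj b c -> colorable_on A w.+1.
Proof.
move=> w3 om IH aA bA cA bc ab ac nab nac nbc.
pose indep (I : {set G}) := (I \subset A) && [forall x in I, forall y in I, ~~ adj x y].
have indepP I : reflect (I \subset A /\ {in I &, forall x y, ~~ adj x y}) (indep I).
  apply: (iffP andP) => -[IA h]; split=> //.
    by move=> x y xI yI; have /forall_inP/(_ y yI) := forall_inP h x xI.
  by apply/forall_inP=> x xI; apply/forall_inP=> y yI; apply: h.
have ind0 : indep [set a; b; c].
  apply/indepP; split.
    by apply/subsetP=> x; rewrite !inE => /orP[/orP[]|] /eqP ->.
  move=> x y; rewrite !inE => /orP[/orP[]|] /eqP -> /orP[/orP[]|] /eqP ->;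
    by rewrite ?adj_irrefl // adj_sym.
have [I /maxsetP[/indepP[IA I0] Imax] subI] := maxset_exists ind0.
have [aI bI cI] : [/\ a \in I, b \in I & c \in I].
  by split; apply: (subsetP subI); rewrite !inE eqxx ?orbT.
have [/existsP[K /and3P[KA cK /eqP Kw]]|] :=
  boolP [exists K : {set G}, [&& K \subset A :\: I, clique K & #|K| == w]]; last first.
  rewrite negb_exists => /forallP noK; apply: (colorable_on_indep I0); apply: IH.
  move=> B BA cB; rewrite -ltnS prednK; last exact: ltn_trans w3.
  rewrite ltn_neqAle om ?(subset_trans BA (subsetDl _ _)) // andbT.
  by have := noK B; rewrite BA cB.
have KA' : K \subset A := subset_trans KA (subsetDl _ _).
have KI k : k \in K -> k \notin I by move/(subsetP KA)/setDP=> [].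
(* by maximality of [I], a vertex missing two elements of [I] would complete
   an edge to [I] into a co-diamond *)
have miss k i j : k \in K -> i \in I -> j \in I -> i != j -> adj i k || adj j k.
  move=> kK iI jI ij; apply: contraT; rewrite negb_or => /andP[nik njk].
  have [/exists_inP[l lI kl]|] := boolP [exists l in I, adj k l].
    case/negP: (I0 i j iI jI).
    by apply: (codiamond_free kl); rewrite ?[adj k _]adj_sym ?(I0 l).
  rewrite negb_exists_in => /forall_inP kI; case/negP: (KI k kK).
  suff <- : k |: I = I by rewrite setU11.
  apply: Imax; last exact: subsetUr.
  apply/indepP; split; first by rewrite subUset sub1set (subsetP KA').
  move=> x y /setU1P[->|xI] /setU1P[->|yI]; rewrite ?adj_irrefl //.
  - exact: kI.
  - by rewrite adj_sym kI.
  exact: I0.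
pose N i := [set k in K | adj i k].
have subN i : N i \subset K by apply/subsetP=> k; rewrite inE => /andP[].
have N2 i : i \in I -> #|N i| <= 2.
  move=> iI; apply: neighbours_in_clique_le2 KA' cK _ _; rewrite ?Kw //.
    exact: (subsetP IA).
  by apply: contraL iI => /KI.
have cover i j : i \in I -> j \in I -> i != j -> K :\: N i \subset N j.
  move=> iI jI ij; apply/subsetP=> k; rewrite !inE => /andP[+ kK]; rewrite kK /=.
  by have := miss k i j kK iI jI ij; case: (adj i k).
have w_eq3 : w = 3.
  have cardD : w <= #|K :\: N a| + 2.
    by rewrite -Kw -(cardsID (N a)) addnC leq_add2l (leq_trans _ (N2 a aI)) // subset_leq_card // subsetIr.
  have KU : K \subset N b :|: N c.
    apply/subsetP=> k kK; have := miss k b c kK bI cI bc.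
    by rewrite !inE kK.
  have := leq_add (subset_leq_card KU) (subset_leq_card (_ : K :\: N a \subset N b :&: N c)).
  rewrite subsetI !cover // cardsUI Kw => /(_ isT) le1.
  have le2 : #|N b| + #|N c| <= 4 by apply: (leq_add (N2 b bI) (N2 c cI)).
  have ww : w + w <= 6.
    rewrite (leq_trans (leq_add (leqnn w) cardD)) //.
    by rewrite addnA (leq_add (leq_trans le1 le2)).
  apply/eqP; rewrite eqn_leq w3 andbT leqNgt; apply/negP=> w4.
  by have := leq_trans (leq_add w4 w4) ww.
rewrite w_eq3 in Kw om *.
have ex i : i \in I -> exists2 k, k \in K & ~~ adj i k.
  move=> iI; have : 0 < #|K :\: N i|.
    by rewrite cardsD (setIidPr (subN i)) Kw subn_gt0 ltnS N2.
  by case/card_gt0P=> k; rewrite !inE => /andP[+ kK]; rewrite kK; exists k.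
have [ka kaK nka] := ex a aI; have [kb kbK nkb] := ex b bI.
have [kc kcK nkc] := ex c cI.
have sym (i j : G) k : i \in I -> j \in I -> k \in K -> i != j -> ~~ adj i k ->
    adj j k.
  by move=> iI jI kK ij /negPf nik; have := miss k i j kK iI jI ij; rewrite nik.
have neq i j k l : i \in I -> j \in I -> k \in K -> i != j -> ~~ adj i k ->
    ~~ adj j l -> k != l.
  move=> iI jI kK ij nik njl.
  by apply: contraNneq njl => <-; apply: sym nik.
have kab : ka != kb by apply: (neq a b).
have kac : ka != kc by apply: (neq a c).
have kbc : kb != kc by apply: (neq b c).
have adjK : {in K &, forall y z, y != z -> adj y z} by apply/cliqueP.
have dIK i k : i \in I -> k \in K -> i != k by move=> iI /KI; apply: contraNneq => <-.
have pf : pattern_free false 3 (@adj G) [in A] by apply: pattern_freeT.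
apply: (refutes_sound pf (s := [:: a; b; c; ka; kb; kc]) (t := sun_tree)).
- by rewrite /= !inE !negb_or ab ac bc kab kac kbc !dIK.
- apply/allP; rewrite /= aA bA cA !(subsetP KA') //.
rewrite /= /row /= ![adj ka _]adj_sym ![adj kb _]adj_sym ![adj kc _]adj_sym.
rewrite [adj b a]adj_sym [adj c a]adj_sym [adj c b]adj_sym.
rewrite (negPf nab) (negPf nac) (negPf nbc) (negPf nka) (negPf nkb) (negPf nkc).
have [ba ca cb] : [/\ b != a, c != a & c != b] by split; rewrite eq_sym.
rewrite (sym a b ka) // (sym a c ka) // (sym b a kb) // (sym b c kb) //.
by rewrite (sym c a kc) // (sym c b kc) // !adjK ?sun_tree_refutes.
Qed.

Lemma colorable_indep_le2 A K : 2 < #|K| -> omega_le A #|K| -> indep_le2 A ->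
  K \subset A -> clique K -> colorable_on A #|K|.+1.
Proof.
move=> K3 om al KA cK; pose N x := [set k in K | adj x k].
have pf : pattern_free true #|K| (@adj G) [in A] by apply: pattern_freeT.
have adjK : {in K &, forall y z, y != z -> adj y z} by apply/cliqueP.
have sKA : {subset K <= A} by apply/subsetP.
have N2 x : x \in A :\: K -> #|N x| <= 2.
  by case/setDP=> xA xK; apply: (neighbours_in_clique_le2 om KA cK).
have [cL|] := boolP (clique (A :\: K)).
  have E : A = K :|: (A :\: K) by rewrite setDE setUIr setUCr setIT; apply/esym/setUidPr.
  rewrite [A in colorable_on A]E.
  apply: cobipartite_colorable => //; first 1 last.
  - exact: ltnW.
  - by rewrite -E.
  by rewrite disjoint_sym disjoints_subset; apply/subsetP=> z /setDP[_]; rewrite inE.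
rewrite negb_forall_in => /exists_inP[x xL]; rewrite negb_forall_in => /exists_inP[y yL].
rewrite negb_imply => /andP[xy nxy].
have [[xA xK] [yA yK]] : (x \in A /\ x \notin K) /\ (y \in A /\ y \notin K).
  by split; apply/setDP.
have xneK k : k \in K -> x != k by apply: contraTneq => <-.
have yneK k : k \in K -> y != k by apply: contraTneq => <-.
have KU : K \subset N x :|: N y.
  apply/subsetP=> k kK; rewrite !inE kK /=; apply: contraT; rewrite negb_or => /andP[nxk nyk].
  by case/negP: nyk; apply: (al x) => //; rewrite ?yneK ?xneK ?sKA.
have leK : #|K| + #|N x :&: N y| <= 4.
  by rewrite (leq_trans (leq_add (subset_leq_card KU) (leqnn _))) // cardsUI (leq_add (N2 x xL) (N2 y yL)).
have : #|K| <= 4 by rewrite (leq_trans (leq_addr _ _) leK).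
rewrite leq_eqVlt => /predU1P[K4|]; last first.
  rewrite ltnS => K3'; have {K3 K3'}K_eq3 : #|K| = 3 by apply/eqP; rewrite eqn_leq K3'.
  have : 2 < #|K| by rewrite K_eq3.
  case/card_gt2P=> a [b [c [[aK bK cKK] [ab bc ca]]]].
  have ac : a != c by rewrite eq_sym.
  rewrite K_eq3 in pf *.
  apply: (refutes_sound pf (s := [:: a; b; c]) (t := K3_tree)).
  - by rewrite /= !inE negb_or ab ac bc.
  - by apply/allP; rewrite /= !sKA.
  by rewrite /= /row /= !adjK ?K3_tree_refutes // eq_sym.
have I0 : N x :&: N y = set0.
  by apply/eqP; rewrite -cards_eq0 -leqn0 -(leq_add2l 4) -{1}K4.
have cU : 4 <= #|N x| + #|N y| by rewrite -cardsUI I0 cards0 addn0 -K4 subset_leq_card.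
have Nx2 : #|N x| == 2.
  by rewrite eqn_leq N2 //= -(leq_add2r 2) (leq_trans cU) // leq_add2l N2.
have Ny2 : #|N y| == 2.
  by rewrite eqn_leq N2 //= -(leq_add2l 2) (leq_trans cU) // leq_add2r N2.
have /cards2P[a [b [ab Nx]]] := Nx2; have /cards2P[c [d [cd Ny]]] := Ny2.
have inN z u v : N z = [set u; v] -> [/\ u \in N z & v \in N z].
  by move=> ->; rewrite !inE !eqxx orbT.
have [aN bN] := inN _ _ _ Nx; have [cN dN] := inN _ _ _ Ny.
have disj k l : k \in N x -> l \in N y -> k != l.
  move=> kN lN; apply/eqP=> E; have : k \in N x :&: N y by rewrite inE kN E lN.
  by rewrite I0 inE.
have NK z k : k \in N z -> k \in K /\ adj z k by rewrite inE => /andP.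
have [[aK xa] [bK xb]] := (NK _ _ aN, NK _ _ bN).
have [[cKK yc] [dK yd]] := (NK _ _ cN, NK _ _ dN).
have nx k : k \in K -> k \in N y -> adj x k = false.
  move=> kK kN; apply/negbTE/negP=> xk; have := disj k k; rewrite eqxx kN.
  by rewrite inE kK xk => /(_ isT isT).
have ny k : k \in K -> k \in N x -> adj y k = false.
  move=> kK kN; apply/negbTE/negP=> yk; have := disj k k; rewrite eqxx kN.
  by rewrite inE kK yk => /(_ isT isT).
have [ac ad bc bd] : [/\ a != c, a != d, b != c & b != d] by split; apply: disj.
rewrite K4 in pf *.
apply: (refutes_sound pf (s := [:: a; b; c; d; x; y]) (t := K4_tree)).
- rewrite /= !inE !negb_or ab ac ad bc bd cd xy.
  by rewrite ![_ == x]eq_sym ![_ == y]eq_sym !xneK // !yneK.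
- by apply/allP; rewrite /= xA yA !sKA.
rewrite /= /row /= xa xb yc yd [adj y x]adj_sym (negPf nxy) !nx // !ny //.
by rewrite !adjK ?K4_tree_refutes // eq_sym.
Qed.

Lemma omega_le_colorable A w : omega_le A w -> colorable_on A w.+1.
Proof.
elim: w A => [|w IH] A om.
  have A0 : A = set0.
    apply/eqP; rewrite -subset0; apply/subsetP=> x xA.
    have : clique [set x].
      by apply/cliqueP=> y z /set1P -> /set1P ->; rewrite eqxx.
    by move/om; rewrite sub1set cards1 => /(_ xA).
  by exists (fun=> 0); split=> x; rewrite A0 inE.
have [/existsP[K /and3P[KA cK /eqP Kw]]|] :=
  boolP [exists K : {set G}, [&& K \subset A, clique K & #|K| == w.+1]]; last first.
  rewrite negb_exists => /forallP noK; apply: (colorable_onW (leqnSn w.+1)).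
  apply: IH => B BA cB; rewrite -ltnS ltn_neqAle om // andbT.
  by have := noK B; rewrite BA cB.
have sKA : {subset K <= A} by apply/subsetP.
have adjK : {in K &, forall y z, y != z -> adj y z} by apply/cliqueP.
have pf : pattern_free false w.+1 (@adj G) [in A] by apply: pattern_freeT.
case: w => [|[|w]] in IH om Kw pf *.
- have /eqP/cards1P[a Ka] := Kw.
  apply: (refutes_sound pf (s := [:: a]) (t := K1_tree)).
  - by [].
  - by apply/allP; rewrite /= sKA // Ka set11.
  exact: K1_tree_refutes.
- have /eqP/cards2P[a [b [ab Kab]]] := Kw.
  have [aK bK] : a \in K /\ b \in K by rewrite Kab !inE !eqxx orbT.
  apply: (refutes_sound pf (s := [:: a; b]) (t := K2_tree)).
  - by rewrite /= inE ab.
  - by apply/allP; rewrite /= !sKA.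
  by rewrite /= /row /= adjK ?K2_tree_refutes // eq_sym.
have [/existsP[a /existsP[b /existsP[c /and3P[/and3P[aA bA cA]]]]]|noI] :=
  boolP [exists a, exists b, exists c, [&& [&& a \in A, b \in A & c \in A],
    [&& b != c, a != b & a != c] & [&& ~~ adj a b, ~~ adj a c & ~~ adj b c]]].
  move=> /and3P[bc ab ac] /and3P[nab nac nbc].
  by apply: (colorable_indep3 (a := a) (b := b) (c := c)).
rewrite -Kw; apply: colorable_indep_le2; rewrite ?Kw //.
move=> a b c aA bA cA bc ab ac nab nac; apply: contraNT noI => nbc.
apply/existsP; exists a; apply/existsP; exists b; apply/existsP; exists c.
by rewrite aA bA cA bc ab ac nab nac nbc.
Qed.

End Coloring.

Theorem theorem4 (G : sgraph) (hG : free [:: K5_minus_e; K2_cup_2K1] G) :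
  chi G <= omega G + 1.
Proof.
have om : omega_le [set: G] (omega G).
  by move=> B _ cB; apply: leq_bigmax_cond.
have [c [clt cP]] :=
  omega_le_colorable (free_no_codiamond hG) (free_no_K5_minus_e hG) om.
rewrite addn1 /chi; case: ex_minnP => m _; apply.
apply/existsP; exists [ffun x => Ordinal (clt x (in_setT x))].
apply/forallP=> x; apply/forallP=> y; apply/implyP=> xy.
by rewrite !ffunE -val_eqE /= cP ?inE.
Qed.
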